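(* Let $X$ and $Y$ be topological spaces. (a) If $f:X\to Y$ is a continuous map, then it induces a homomorphism of Boolean algebras $\widetilde{f}:\mathrm{Clop}(Y)\to \mathrm{Clop}(X)$. (b) If $f:X\to Y$ is a homeomorphism, then it induces an isomorphism of Boolean algebras $\widetilde{f}:\mathrm{Clop}(Y)\to \mathrm{Clop}(X)$.
   Context: A Boolean algebra $(B,+,\cdot,\neg)$ is written with join $+$, meet $\cdot$ and complement $\neg$, with bottom $0$ and top $1$. A homomorphism of Boolean algebras is a map preserving $+$, $\cdot$, $0$ and $1$. For a topological space $X$, $\mathrm{Clop}(X)$ is the family of all clopen (closed and open) subsets of $X$; it is a Boolean algebra with $+=\cup$, $\cdot=\cap$, $\neg A=X\setminus A$, $0=\emptyset$, $1=X$. The map induced by a continuous map $f:X\to Y$ is $\widetilde{f}(U)=f^{-1}(U)$ for $U\in\mathrm{Clop}(Y)$. *)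

(* Defs.v *)
From HB Require Import structures.
From mathcomp Require Import all_boot all_order all_algebra.
From mathcomp Require Import all_classical.
From mathcomp Require Import topology.

Set Implicit Arguments.
Unset Strict Implicit.
Unset Printing Implicit Defensive.

Import Order.TTheory.
Local Open Scope classical_set_scope.

(* Boolean algebras are rendered by [ctbDistrLatticeType] (bounded distributive
   lattices with a complement): join is +, meet is the product, [\bot] is 0 and
   [\top] is 1.  The library's [{tblmorphism _ -> _}] is not used below: it only
   asks for the preservation of [\bot] and [\top], not of meets and joins. *)
Definition ba_hom d (A : ctbDistrLatticeType d) d' (B : ctbDistrLatticeType d')
    (h : A -> B) : Prop :=
  [/\ Order.join_morphism h, Order.meet_morphism h, h \bot%O = \bot%O
    & h \top%O = \top%O].

Definition ba_iso d (A : ctbDistrLatticeType d) d' (B : ctbDistrLatticeType d')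
    (h : A -> B) : Prop :=
  ba_hom h /\ bijective h.

Definition homeomorphism (X Y : topologicalType) (f : X -> Y) : Prop :=
  continuous f /\
  exists g : Y -> X, [/\ cancel f g, cancel g f & continuous g].

Definition Clop (X : topologicalType) : Type := set_type (@clopen X).

HB.instance Definition _ (X : topologicalType) :=
  SubChoice.copy (Clop X) (set_type (@clopen X)).

Section ClopAlgebra.
Context {X : topologicalType}.
Implicit Types A B C : Clop X.

Definition mkClop (U : set X) (cU : clopen U) : Clop X := SigSub (mem_set cU).

Lemma clopP A : clopen (\val A). Proof. exact: set_valP. Qed.

Definition clopU A B : Clop X := mkClop (clopenU (clopP A) (clopP B)).
Definition clopI A B : Clop X := mkClop (clopenI (clopP A) (clopP B)).
Definition clopC A : Clop X := mkClop (clopenC setT (clopP A)).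
Definition clop0 : Clop X := mkClop clopen0.
Definition clopT : Clop X := mkClop clopenT.

Let le A B := `[< \val A `<=` \val B >].
Let lt A B := `[< \val A `<` \val B >].

Let le_def A B : le A B = (clopI A B == A).
Proof. by rewrite -(inj_eq val_inj) /le SetOrder.Internal.le_def. Qed.

Let lt_def A B : lt A B = (B != A) && le A B.
Proof. by rewrite -(inj_eq val_inj) /lt SetOrder.Internal.lt_def. Qed.

Let meetC : commutative clopI.
Proof. by move=> A B; apply/val_inj/setIC. Qed.

Let joinC : commutative clopU.
Proof. by move=> A B; apply/val_inj/setUC. Qed.

Let meetA : associative clopI.
Proof. by move=> A B C; apply/val_inj/setIA. Qed.

Let joinA : associative clopU.
Proof. by move=> A B C; apply/val_inj/setUA. Qed.

Let joinKI B A : clopI A (clopU A B) = A.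
Proof. by apply/val_inj/SetOrder.Internal.joinKI. Qed.

Let meetKU B A : clopU A (clopI A B) = A.
Proof. by apply/val_inj/SetOrder.Internal.meetKU. Qed.

Let meetUl : left_distributive clopI clopU.
Proof. by move=> A B C; apply/val_inj/setIUl. Qed.

Let meetxx : idempotent_op clopI.
Proof. by move=> A; apply/val_inj/setIid. Qed.

HB.instance Definition _ :=
  Order.isMeetJoinDistrLattice.Build set_display (Clop X)
    le_def lt_def meetC joinC meetA joinA joinKI meetKU meetUl meetxx.

Let le0x A : (clop0 <= A)%O.
Proof. by apply/asboolP; exact: sub0set. Qed.

Let lex1 A : (A <= clopT)%O.
Proof. exact/asboolP. Qed.

HB.instance Definition _ := Order.hasBottom.Build set_display (Clop X) le0x.
HB.instance Definition _ := Order.hasTop.Build set_display (Clop X) lex1.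

Let joinxC A : (A `|` clopC A)%O = \top%O.
Proof. by apply/val_inj/setUv. Qed.

Let meetxC A : (A `&` clopC A)%O = \bot%O.
Proof. by apply/val_inj/setICr. Qed.

HB.instance Definition _ :=
  Order.TBDistrLattice_hasComplement.Build set_display (Clop X) joinxC meetxC.

Lemma val_clopU A B : \val (A `|` B)%O = \val A `|` \val B.
Proof. by []. Qed.

Lemma val_clopI A B : \val (A `&` B)%O = \val A `&` \val B.
Proof. by []. Qed.

Lemma val_clopC A : \val (~` A)%O = ~` \val A.
Proof. by []. Qed.

Lemma val_clop0 : \val (\bot%O : Clop X) = set0. Proof. by []. Qed.

Lemma val_clopT : \val (\top%O : Clop X) = setT. Proof. by []. Qed.

End ClopAlgebra.

(* [h] is the map induced by [f]; it is determined by [f], and its existence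
   amounts to preimages of clopen sets under [f] being clopen. *)
Definition induced_map (X Y : topologicalType) (f : X -> Y)
    (h : Clop Y -> Clop X) : Prop :=
  forall U : Clop Y, \val (h U) = f @^-1` (\val U).

(* Main.v *)
Require Import Defs.
From HB Require Import structures.
From mathcomp Require Import all_boot all_order all_algebra.
From mathcomp Require Import all_classical.
From mathcomp Require Import topology.

(** Preimages under a continuous map of clopen sets are clopen, so [U |-> f^-1(U)]
    is a map from [Clop Y] to [Clop X]. Equality in [Clop X] is equality of the
    underlying sets, and taking preimages commutes with unions and
    intersections, so every map induced by [f] is a Boolean algebra homomorphism.
    The construction is contravariantly functorial: if [g] is a continuous inverse
    of [f], the map induced by [g] is a two-sided inverse of the map induced by
    [f], since [f^-1(g^-1(U)) = (g \o f)^-1(U) = U], and symmetrically. *)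

Lemma continuous_induced_map (X Y : topologicalType) (f : X -> Y) :
  continuous f -> exists h : Clop Y -> Clop X, induced_map f h.
Proof.
by move=> cf; exists (fun U => mkClop (preimage_clopen (clopP U) cf)).
Qed.

Lemma induced_map_ba_hom (X Y : topologicalType) (f : X -> Y)
    (h : Clop Y -> Clop X) : induced_map f h -> ba_hom h.
Proof.
move=> fh; split=> [U V|U V||]; apply: val_inj.
- by rewrite val_clopU !fh val_clopU preimage_setU.
- by rewrite val_clopI !fh val_clopI preimage_setI.
- by rewrite fh !val_clop0 preimage_set0.
- by rewrite fh !val_clopT preimage_setT.
Qed.

(** Contravariance swaps the roles: a left inverse of [f] induces a right inverse
    of the map induced by [f]. *)
Lemma induced_map_cancel (X Y : topologicalType) (f : X -> Y) (g : Y -> X)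
    (h : Clop Y -> Clop X) (k : Clop X -> Clop Y) :
  induced_map f h -> induced_map g k -> cancel f g -> cancel k h.
Proof.
move=> fh gk fK U; apply: val_inj; rewrite fh gk.
by apply/seteqP; split=> x /=; rewrite fK.
Qed.

Theorem proposition2p13 (X Y : topologicalType) :
  (forall f : X -> Y, continuous f ->
     exists h : Clop Y -> Clop X, induced_map f h /\ ba_hom h) /\
  (forall f : X -> Y, homeomorphism f ->
     exists h : Clop Y -> Clop X, induced_map f h /\ ba_iso h).
Proof.
split=> [f cf|f [cf [g [fK gK cg]]]].
  have [h fh] := continuous_induced_map _ _ f cf.
  by exists h; split=> //; exact: induced_map_ba_hom fh.
have [h fh] := continuous_induced_map _ _ f cf.
have [k gk] := continuous_induced_map _ _ g cg.
exists h; split=> //; split; first exact: induced_map_ba_hom fh.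
exists k.
- exact: induced_map_cancel gk fh gK.
- exact: induced_map_cancel fh gk fK.
Qed.
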